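(* For every integer $k\ge 2$ there is an undirected graph $G_k$ with $n\in O(2^k k)$ vertices and $m\in O(2^k k^2)$ edges such that $\operatorname{cost}(\alpha)\in\Omega((m+n)\log n)$, where $\alpha$ is the unit partition of $V(G_k)$.
   Context: Let $G=(V,E)$ be an undirected graph. For a partition $\pi$ of $V$, a set is $\pi$-closed if it is a union of cells of $\pi$; $u\approx_\pi v$ means $u,v$ lie in a common cell. A partition $\pi$ is stable if for all $u\approx_\pi v$ and every cell $R\in\pi$, $|N(u)\cap R|=|N(v)\cap R|$. For $\pi$-closed sets $R,S\subseteq V$, the partition $\pi(R,S)$ obtained by the refining operation $(R,S)$ is defined by: every cell of $\pi$ disjoint from $S$ is a cell of $\pi(R,S)$, and for $u,v\in S$, $u\approx_{\pi(R,S)}v$ iff $u\approx_\pi v$ and $|N(u)\cap R'|=|N(v)\cap R'|$ for all cells $R'\in\pi$ with $R'\subseteq R$. The operation is effective if $\pi(R,S)\ne\pi$. Its cost is $\operatorname{cost}(R,S)=|\{(u,v): uv\in E, u\in R, v\in S\}|$. Recursively, $\operatorname{cost}(\pi)=0$ if $\pi$ is stable, and otherwise $\operatorname{cost}(\pi)=\min_{(R,S)}\big(\operatorname{cost}(\pi(R,S))+\operatorname{cost}(R,S)\big)$ over all effective refining operations $(R,S)$ applicable to $\pi$. The unit partition is $\{V\}$. *)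

(* Defs.v *)
From mathcomp Require Import all_boot.

Set Implicit Arguments.
Unset Strict Implicit.
Unset Printing Implicit Defensive.

Section ColourRefinement.
Variables (V : finType) (e : rel V).
Implicit Types (pi : {set {set V}}) (R S : {set V}) (u v : V).

Definition nbh u : {set V} := [set v | e u v].

Definition edges : {set {set V}} := [set [set p.1; p.2] | p : V * V & e p.1 p.2].

Definition pi_closed pi S : bool :=
  [exists Q : {set {set V}}, (Q \subset pi) && (S == cover Q)].

Definition same_cell pi u v : bool :=
  [exists B in pi, (u \in B) && (v \in B)].

Definition stable pi : bool :=
  [forall u, forall v, same_cell pi u v ==>
    [forall R in pi, #|nbh u :&: R| == #|nbh v :&: R|]].

Definition refine_rel pi R u v : bool :=
  same_cell pi u v &&
  [forall R' in pi, (R' \subset R) ==> (#|nbh u :&: R'| == #|nbh v :&: R'|)].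

Definition refine pi R S : {set {set V}} :=
  [set B in pi | [disjoint B & S]] :|: equivalence_partition (refine_rel pi R) S.

Definition effective pi R S : bool :=
  [&& pi_closed pi R, pi_closed pi S & refine pi R S != pi].

(* Ordered pairs: an edge with both ends in R :&: S counts twice. *)
Definition op_cost R S : nat :=
  #|[set p : V * V | [&& e p.1 p.2, p.1 \in R & p.2 \in S]]|.

(* The recursion is run with fuel. An effective operation increases the number
   of cells, so #|V| is enough fuel; cost_stable and costP below show that
   [cost] satisfies the intended recursion. The starting point (setT, setT) of
   the minimisation is itself effective whenever [pi] is not stable. *)
Fixpoint cost_rec (fuel : nat) pi : nat :=
  if stable pi then 0 else
  if fuel is fuel'.+1 then
    let F := fun RS : {set V} * {set V} =>
      cost_rec fuel' (refine pi RS.1 RS.2) + op_cost RS.1 RS.2 in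
    F [arg min_(RS < ([set: V], [set: V]) | effective pi RS.1 RS.2) F RS]
  else 0.

Definition cost pi : nat := cost_rec #|V| pi.

Definition unit_partition : {set {set V}} := [set [set: V]].

Lemma same_cellE pi u v : partition pi [set: V] ->
  same_cell pi u v = (v \in pblock pi u).
Proof.
case/and3P=> /eqP covP tiP _; apply/idP/idP => [|uv].
  by case/exists_inP=> B piB /andP[uB vB]; rewrite (def_pblock tiP piB uB).
apply/exists_inP; exists (pblock pi u); first by rewrite pblock_mem // covP inE.
by rewrite mem_pblock covP inE.
Qed.

Lemma refine_rel_equiv pi R : partition pi [set: V] ->
  equivalence_rel (refine_rel pi R).
Proof.
move=> partP; have /and3P[/eqP covP tiP _] := partP => u v w.
rewrite /refine_rel !same_cellE // mem_pblock covP inE; split.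
  by apply/forall_inP=> R' _; apply/implyP.
case/andP=> /(same_pblock tiP) <- /forall_inP uv; congr (_ && _).
apply: eq_forallb => R'; case piR: (R' \in pi) => //=.
by case RR: (R' \subset R) => //=; have /implyP/(_ RR)/eqP-> := uv _ piR.
Qed.

Lemma refine_partition pi R S : partition pi [set: V] -> pi_closed pi S ->
  partition (refine pi R S) [set: V].
Proof.
move=> partP /existsP[Q /andP[sQ /eqP defS]].
have /and3P[/eqP covP tiP n0] := partP.
have eqR : {in S & &, equivalence_rel (refine_rel pi R)}.
  by move=> u v w _ _ _; apply: refine_rel_equiv.
have /and3P[/eqP covE tiE n0E] := equivalence_partitionP eqR.
have disjS B : B \in pi -> [disjoint B & S] || (B \subset S).
  move=> piB; case: (boolP (B \in Q)) => BQ.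
    by rewrite defS (bigcup_max B) ?orbT.
  rewrite defS bigcup_disjoint // => C CQ.
  apply: (trivIsetP tiP) => //; first exact: (subsetP sQ).
  by apply: contraNneq BQ => ->.
apply/and3P; split; last first.
- by rewrite in_setU negb_or n0E andbT inE negb_and n0.
- apply/trivIsetP=> A B.
  have eqS C : C \in equivalence_partition (refine_rel pi R) S -> C \subset S.
    by move=> CE; rewrite -covE; apply: (bigcup_max C).
  rewrite /refine => /setUP[/setIdP[Ap Ad]|AE] /setUP[/setIdP[Bp Bd]|BE] nAB.
  + exact: (trivIsetP tiP).
  + exact: (disjointWr (eqS _ BE)).
  + by rewrite disjoint_sym; apply: (disjointWr (eqS _ AE)).
  + exact: (trivIsetP tiE).
apply/eqP/setP=> x; rewrite [RHS]inE; apply/bigcupP.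
case: (boolP (x \in S)) => xS.
  have /bigcupP[B BE xB] :
      x \in cover (equivalence_partition (refine_rel pi R) S).
    by rewrite covE.
  by exists B => //; apply/setUP; right.
have xp : x \in cover pi by rewrite covP inE.
exists (pblock pi x); last by rewrite mem_pblock.
rewrite in_setU; apply/orP; left; rewrite inE pblock_mem //=.
case/orP: (disjS _ (pblock_mem xp)) => // /subsetP/(_ x).
by rewrite mem_pblock xp (negPf xS) => /(_ isT).
Qed.

Lemma refine_finer pi R S B : partition pi [set: V] -> B \in refine pi R S ->
  exists2 C, C \in pi & B \subset C.
Proof.
move=> partP; have /and3P[/eqP covP _ _] := partP.
case/setUP=> [/setIdP[Bp _]|/imsetP[x xS ->]]; first by exists B.
exists (pblock pi x); first by rewrite pblock_mem // covP inE.
by apply/subsetP=> y; rewrite inE => /and3P[_ + _]; rewrite same_cellE.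
Qed.

Lemma effective_card pi R S : partition pi [set: V] -> effective pi R S ->
  #|pi| < #|refine pi R S|.
Proof.
move=> partP /and3P[_ clS]; rewrite ltnNge; apply: contra => lecard.
have partP' := refine_partition R partP clS.
have /and3P[/eqP cov' ti' n0'] := partP'.
have /and3P[/eqP cov ti n0] := partP.
set pi' := refine pi R S in lecard partP' cov' ti' n0' *.
pose f (B : {set V}) := if [pick x in B] is Some x then pblock pi x else set0.
have fE B x : B \in pi' -> x \in B -> f B = pblock pi x.
  move=> B' xB; have [C piC /subsetP sBC] := refine_finer partP B'.
  rewrite /f; case: pickP => [y yB|/(_ x)]; last by rewrite xB.
  by rewrite !(def_pblock ti piC) ?sBC.
have fim : f @: pi' = pi.
  apply/setP=> C; apply/imsetP/idP => [[B B' ->]|piC].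
    have /set0Pn[x xB] : B != set0 by apply: contraNneq n0' => <-.
    by rewrite (fE _ _ B' xB) pblock_mem // cov inE.
  have /set0Pn[x xC] : C != set0 by apply: contraNneq n0 => <-.
  have x' : x \in cover pi' by rewrite cov' inE.
  exists (pblock pi' x); first exact: pblock_mem.
  by rewrite (fE _ x) ?pblock_mem ?mem_pblock // (def_pblock ti piC).
have finj : {in pi' &, injective f}.
  by apply/imset_injP; rewrite eqn_leq leq_imset_card fim.
have fid B : B \in pi' -> f B = B.
  move=> B'; have /set0Pn[x xB] : B != set0 by apply: contraNneq n0' => <-.
  have fBx := fE _ _ B' xB.
  apply/setP=> y; apply/idP/idP => [yf|yB]; last first.
    by rewrite (fE _ _ B' yB) mem_pblock cov inE.
  have y' : y \in cover pi' by rewrite cov' inE.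
  have By := pblock_mem y'.
  have yBy : y \in pblock pi' y by rewrite mem_pblock.
  suff -> : B = pblock pi' y by [].
  apply: finj => //; rewrite (fE _ _ By yBy) fBx.
  by rewrite fBx in yf; rewrite (same_pblock ti yf).
by apply/eqP; rewrite -[RHS]fim -[LHS]imset_id; apply: eq_in_imset => B /fid.
Qed.

Lemma card_partition_le pi : partition pi [set: V] -> #|pi| <= #|V|.
Proof.
case/and3P=> /eqP cov ti n0.
suff -> : pi = pblock pi @: [set: V] by rewrite -cardsT leq_imset_card.
apply/setP=> C; apply/idP/imsetP => [piC|[x _ ->]]; last first.
  by rewrite pblock_mem // cov inE.
have /set0Pn[x xC] : C != set0 by apply: contraNneq n0 => <-.
by exists x; rewrite ?inE // (def_pblock ti piC).
Qed.

Lemma effective_setT pi : partition pi [set: V] -> ~~ stable pi ->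
  effective pi [set: V] [set: V].
Proof.
move=> partP; have /and3P[/eqP cov ti n0] := partP.
have clT : pi_closed pi [set: V].
  by apply/existsP; exists pi; rewrite subxx cov eqxx.
rewrite /effective clT /=; apply: contra => /eqP fixP.
apply/forallP=> u; apply/forallP=> v; apply/implyP=> uv.
have eqR : {in [set: V] & &, equivalence_rel (refine_rel pi [set: V])}.
  by move=> x y z _ _ _; apply: refine_rel_equiv.
case/exists_inP: uv => B; rewrite -{1}fixP.
case/setUP=> [/setIdP[_ /pred0P dB] /andP[uB _]|/imsetP[x _ ->]].
  by have := dB u; rewrite /= uB inE.
rewrite !inE /= => /andP[xu xv].
have := refine_rel_equiv [set: V] partP x u v => -[_ /(_ xu) E].
move: xv; rewrite E => /andP[_ /forall_inP uv].
by apply/forall_inP=> R piR; have /implyP := uv _ piR; apply; apply: subsetT.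
Qed.

Lemma cost_rec_fuel m n pi : partition pi [set: V] ->
  #|V| - #|pi| <= m -> #|V| - #|pi| <= n -> cost_rec m pi = cost_rec n pi.
Proof.
elim: m n pi => [|m IHm] [|n] pi partP //= le_m le_n; case: ifPn => // nst;
  have effT := effective_setT partP nst; have cT := effective_card partP effT;
  have [_ clT _] := and3P effT;
  have leT := card_partition_le (refine_partition [set: V] partP clT).
- by move: le_m; rewrite leqn0 subn_eq0 leqNgt (leq_trans cT).
- by move: le_n; rewrite leqn0 subn_eq0 leqNgt (leq_trans cT).
have eqF RS : effective pi RS.1 RS.2 ->
    cost_rec m (refine pi RS.1 RS.2) = cost_rec n (refine pi RS.1 RS.2).
  move=> eff; have c := effective_card partP eff; have [_ cl _] := and3P eff.
  apply: IHm; first exact: refine_partition.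
  - by rewrite leq_subLR (leq_trans _ (leq_add c (leqnn m))) // addSnnS -leq_subLR.
  - by rewrite leq_subLR (leq_trans _ (leq_add c (leqnn n))) // addSnnS -leq_subLR.
case: arg_minnP => //= A effA minA; case: arg_minnP => //= B effB minB.
apply/eqP; rewrite eqn_leq; apply/andP; split.
  by rewrite -(eqF _ effB) minA.
by rewrite (eqF _ effA) minB.
Qed.

Lemma cost_stable pi : stable pi -> cost pi = 0.
Proof. by rewrite /cost; case: #|V| => [|n] /= ->. Qed.

Lemma costP pi : partition pi [set: V] -> ~~ stable pi ->
  (forall R S, effective pi R S -> cost pi <= cost (refine pi R S) + op_cost R S) /\
  (exists R S, effective pi R S /\ cost pi = cost (refine pi R S) + op_cost R S).
Proof.
move=> partP nst; have effT := effective_setT partP nst.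
have -> : cost pi = cost_rec #|V|.+1 pi.
  by apply: cost_rec_fuel => //; rewrite ?leqW ?leq_subr.
rewrite [cost_rec _ _]/= (negPf nst) -/(cost_rec _ _).
case: arg_minnP => //= A effA minA; split.
  by move=> R S eff; apply: (minA (R, S)).
by exists A.1, A.2.
Qed.

End ColourRefinement.

(* Main.v *)
(** Edges x_(i,j) -- y_(i,j') form 2^k disjoint copies of K_(k,k), indexed by binary
words i of length k.  The rest of the graph is cheap and forces the refinement
to proceed bit by bit: once all the x are split according to their first l+1 bits,
the y can follow only by paying, for each word p of length l, at least
2^(k-l-1) k^2 of the edges below p; and a binary tree of Cai-Fuerer-Immerman
"and" gadgets ensures that the x are not split according to their next bit
before the y are split below every p.  Each of the k levels thus costs
2^(k-1) k^2.

The lower bound is a potential argument.  While p is not paid for, the involution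
that flips the bit following p preserves all the cheap edges, and no refining
operation can separate a vertex from its image under it. *)
From HB Require Import structures.
Require Import Defs.
From mathcomp Require Import all_boot all_order all_algebra.
From mathcomp Require Import reals exp.
From mathcomp Require Import zify.

Set Implicit Arguments.
Unset Strict Implicit.
Unset Printing Implicit Defensive.
Import Order.TTheory GRing.Theory Num.Theory.

(** * Bit flips *)

Fixpoint flip (d : nat) (s : seq bool) : seq bool :=
  match s, d with
  | [::], _ => [::]
  | b :: s', 0 => ~~ b :: s'
  | b :: s', d'.+1 => b :: flip d' s'
  end.

(* Flips the bit following [p], on the proper extensions of [p] only. *)
Fixpoint cflip (p s : seq bool) : seq bool :=
  match s, p with
  | [::], _ => [::]
  | b :: s', [::] => ~~ b :: s'
  | b :: s', a :: p' => b :: (if a == b then cflip p' s' else s')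
  end.

Lemma size_flip d s : size (flip d s) = size s.
Proof. by elim: s d => [|b s IHs] [|d] //=; rewrite IHs. Qed.

Lemma size_cflip p s : size (cflip p s) = size s.
Proof. by elim: s p => [|b s IHs] [|a p] //=; case: eqP => // _; rewrite IHs. Qed.

Lemma flipK d : involutive (flip d).
Proof. by move=> s; elim: s d => [|b s IHs] [|d] //=; rewrite ?negbK ?IHs. Qed.

Lemma cflipK p : involutive (cflip p).
Proof.
move=> s; elim: s p => [|b s IHs] [|a p] //=; rewrite ?negbK //.
by case: eqP => // _; rewrite IHs.
Qed.

Lemma flip_oversize d s : size s <= d -> flip d s = s.
Proof. by elim: s d => [|b s IHs] [|d] //= le_sd; rewrite IHs. Qed.

Lemma cflip_oversize p s : size s <= size p -> cflip p s = s.
Proof.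
by elim: s p => [|b s IHs] [|a p] //= le_sp; case: eqP => // _; rewrite IHs.
Qed.

Lemma nth_flip d s m : m < size s ->
  nth false (flip d s) m = nth false s m (+) (m == d).
Proof.
elim: s d m => [|b s IHs] [|d] [|m] //= lt_ms; rewrite ?addbF ?addbT ?eqSS //.
exact: IHs.
Qed.

Lemma nth_cflip p s m : m < size s ->
  nth false (cflip p s) m
  = nth false s m (+) ((m == size p) && (take m s == p)).
Proof.
elim: s p m => [|b s IHs] [|a p] [|m] //= lt_ms; rewrite ?addbF ?addbT ?eqSS //.
rewrite eqseq_cons [b == a]eq_sym; case: eqP => _ /=; first exact: IHs.
by rewrite andbF addbF.
Qed.

Lemma take_flip d s m : m <= d -> take m (flip d s) = take m s.
Proof. by elim: s d m => [|b s IHs] [|d] [|m] //= le_md; rewrite IHs. Qed.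

Lemma take_cflip p s m : take m (cflip p s) = cflip p (take m s).
Proof.
elim: s p m => [|b s IHs] [|a p] [|m] //=.
by case: eqP => // _; rewrite IHs.
Qed.

Lemma cflip_take d s : cflip (take d s) s = flip d s.
Proof. by elim: s d => [|b s IHs] [|d] //=; rewrite eqxx IHs. Qed.

Lemma cflip_rcons p q c :
  cflip p (rcons q c) = rcons (cflip p q) (c (+) (q == p)).
Proof.
elim: q p => [|b q IHq] [|a p] /=; first by rewrite eqxx addbT.
- by rewrite addbF; case: eqP; case: p.
- by rewrite addbF.
rewrite eqseq_cons [b == a]eq_sym; case: eqP => _ /=; last by rewrite addbF.
by rewrite IHq.
Qed.

Lemma prefix_cflip p q : prefix (cflip p q) p = prefix q p.
Proof.
have [/cflip_oversize-> //|lt_pq] := leqP (size q) (size p).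
by apply/idP/idP => /size_prefix; rewrite ?size_cflip leqNgt lt_pq.
Qed.

Lemma prefix_rcons_ltn (q p : seq bool) c : prefix (rcons q c) p -> size q < size p.
Proof. by move/size_prefix; rewrite size_rcons. Qed.

Arguments flip : simpl never.
Arguments cflip : simpl never.

(** A proper prefix of [p] has exactly one child that is again a prefix of [p]; this parity lets the
    gadget edges survive a switch. *)
Lemma prefix_addb (q p : seq bool) : size q < size p ->
  prefix (rcons q false) p (+) prefix (rcons q true) p = prefix q p.
Proof.
elim: q p => [|b q IHq] [|a p] //= lt_qp; last by case: (b == a); rewrite //= IHq.
by rewrite !prefix0s; case: a.
Qed.

Lemma prefix_rconsxx (p : seq bool) c : prefix (rcons p c) p = false.
Proof. by apply/negP => /prefix_rcons_ltn; rewrite ltnn. Qed.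

(** * The graph *)

(* [XX i j] and [YY i j] are x_(i,j) and y_(i,j).  [WW l q c], for c = 0, 1, is the
   pair attached to the node q of the gadget tree of level l, and the [MM l q a b]
   are the inner vertices of the gadget at q.  Only the nodes with [size q <= l]
   matter; the others give isolated vertices. *)
Inductive core (k : nat) :=
  | XX of k.-tuple bool & 'I_k
  | YY of k.-tuple bool & 'I_k
  | WW of 'I_k & k.-bseq bool & bool
  | MM of 'I_k & k.-bseq bool & bool & bool.

Definition core_code k (u : core k) : k.-tuple bool * 'I_k +
    (k.-tuple bool * 'I_k + 'I_k * k.-bseq bool * (bool + bool * bool)) :=
  match u with
  | XX i j => inl (i, j)
  | YY i j => inr (inl (i, j))
  | WW l q c => inr (inr (l, q, inl c))
  | MM l q a b => inr (inr (l, q, inr (a, b)))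
  end.

Definition core_decode k (s : k.-tuple bool * 'I_k +
    (k.-tuple bool * 'I_k + 'I_k * k.-bseq bool * (bool + bool * bool))) :=
  match s with
  | inl (i, j) => XX i j
  | inr (inl (i, j)) => YY i j
  | inr (inr (l, q, inl c)) => WW l q c
  | inr (inr (l, q, inr (a, b))) => MM l q a b
  end.

Lemma core_codeK k : cancel (@core_code k) (@core_decode k).
Proof. by case. Qed.

HB.instance Definition _ k := Finite.copy (core k) (can_type (@core_codeK k)).

Lemma card_core k :
  #|{: core k}| = 2 ^ k * k + (2 ^ k * k + k * (2 ^ k.+1).-1 * 6).
Proof.
rewrite -(card_codom (can_inj (@core_codeK k))) (@eq_card _ _ predT) => [|s].
  rewrite !(card_sum, card_prod, card_tuple, card_ord, card_bseq, card_bool).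
  by rewrite (predn_exp 2) mul1n.
apply/codomP; exists (core_decode s); case: s => [[]|[[]|[[l q] [c|[a b]]]]] //.
Qed.

(* Hub h is joined to the fillers [Fill h' t] with h' <= h; there are so many of
   them that its degree singles it out. *)
Inductive vertex (k : nat) :=
  | Core of core k
  | Hub of 'I_3
  | Fill of 'I_3 & 'I_(#|{: core k}| + 4).

Definition vertex_code k (u : vertex k) :
    core k + ('I_3 + 'I_3 * 'I_(#|{: core k}| + 4)) :=
  match u with
  | Core u => inl u
  | Hub h => inr (inl h)
  | Fill h t => inr (inr (h, t))
  end.

Definition vertex_decode k
    (s : core k + ('I_3 + 'I_3 * 'I_(#|{: core k}| + 4))) : vertex k :=
  match s with
  | inl u => Core u
  | inr (inl h) => Hub _ h
  | inr (inr (h, t)) => Fill h t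
  end.

Lemma vertex_codeK k : cancel (@vertex_code k) (@vertex_decode k).
Proof. by case. Qed.

HB.instance Definition _ k := Finite.copy (vertex k) (can_type (@vertex_codeK k)).

Lemma card_vertex k : #|{: vertex k}| = #|{: core k}| + (3 + 3 * (#|{: core k}| + 4)).
Proof.
rewrite -(card_codom (can_inj (@vertex_codeK k))) (@eq_card _ _ predT) => [|s].
  by rewrite !card_sum !card_prod !card_ord.
apply/codomP; exists (vertex_decode s); case: s => [|[|[]]] //.
Qed.

Local Notation X i j := (Core (XX i j)).
Local Notation Y i j := (Core (YY i j)).
Local Notation W l q c := (Core (WW l q c)).
Local Notation M l q a b := (Core (MM l q a b)).

(* Colour refinement splits the pair W l q only once both pairs W l q0 and W l q1
   are split; a pair W l q with size q = l is split once the y below q are split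
   by their bit l, and the root pair passes this on to bit l+1 of all the x. *)
Definition arc k (u v : vertex k) : bool :=
  match u, v with
  | X i _, W l q c =>
      [&& q == [::] :> seq bool, l.+1 < k & c == nth false i l.+1]
  | Y i _, W l q c => (q == take l i :> seq bool) && (c == nth false i l)
  | M l q a b, W l' q' c =>
      [&& l' == l, size q < l &
          (q' : seq bool, c) \in
            [:: (rcons q false, a); (rcons q true, b); (q : seq bool, a (+) b)]]
  | Hub h, X i _ => (h == 0 :> nat) || (h == 2 :> nat) && ~~ nth false i 0
  | Hub h, Y _ _ => h == 1 :> nat
  | Hub h, Fill h' _ => h' <= h
  | _, _ => false
  end.

Definition cross k (u v : vertex k) : bool :=
  match u, v with
  | X i _, Y i' _ => i == i'
  | _, _ => false
  end.

Definition cheap k (u v : vertex k) := arc u v || arc v u.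
Definition adj k (u v : vertex k) := [|| cheap u v, cross u v | cross v u].

Lemma adj_sym k : symmetric (@adj k).
Proof. by move=> u v; rewrite /adj /cheap orbC [cross u v || _]orbC orbC [arc v u || _]orbC. Qed.

Lemma adj_irr k : irreflexive (@adj k).
Proof. by case=> [[i j|i j|l q c|l q a b]|h|h t]. Qed.

(** * Involutions that preserve the cheap edges *)

Definition tflip k d (i : k.-tuple bool) : k.-tuple bool :=
  Tuple (introT eqP (etrans (size_flip d i) (size_tuple i))).
Definition tcflip k p (i : k.-tuple bool) : k.-tuple bool :=
  Tuple (introT eqP (etrans (size_cflip p i) (size_tuple i))).
Lemma size_bcflip k p (q : k.-bseq bool) : size (cflip p q) <= k.
Proof. by rewrite size_cflip size_bseq. Qed.
Definition bcflip k p (q : k.-bseq bool) : k.-bseq bool := Bseq (size_bcflip p q).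

(* Below p the y and the nodes are flipped, which in the tree of level [size p]
   swaps the pair at p; parity in the gadgets then forces the pairs at all the
   prefixes of p to be swapped, and the root pair forces every x to be flipped. *)
Definition switch k (p : seq bool) (u : vertex k) : vertex k :=
  match u with
  | X i j => X (tflip (size p).+1 i) j
  | Y i j => Y (tcflip p i) j
  | W l q c => W l (bcflip p q) (c (+) ((l == size p :> nat) && prefix q p))
  | M l q a b =>
      let q_p := q == p :> seq bool in
      let turn c := (l == size p :> nat) && prefix (rcons q c) p in
      M l (bcflip p q)
        ((if q_p then b else a) (+) turn false) ((if q_p then a else b) (+) turn true)
  | _ => u
  end.

Lemma switchK k p : involutive (@switch k p).
Proof.
case=> [[i j|i j|l q c|l q a b]|h|h t] //=.
- by congr (X _ _); apply: val_inj; apply: flipK.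
- by congr (Y _ _); apply: val_inj; apply: cflipK.
- rewrite prefix_cflip -addbA addbb addbF.
  by congr (W _ _ _); apply: val_inj; apply: cflipK.
have -> : bcflip p (bcflip p q) = q by apply: val_inj; apply: cflipK.
have [/= q_p|n_qp] := eqVneq (q : seq bool) p.
  have -> : cflip p q = p by rewrite q_p cflip_oversize.
  by rewrite q_p eqxx !prefix_rconsxx !andbF !addbF.
have -> : (cflip p q == p) = false.
  apply/negbTE; apply: contraNneq n_qp => eq_p.
  by rewrite -[bseqval q](cflipK p) eq_p cflip_oversize.
have E c : prefix (rcons (cflip p q) c) p = prefix (rcons q c) p.
  by rewrite -(prefix_cflip p (rcons q c)) cflip_rcons (negPf n_qp) addbF.
by rewrite !E -!addbA !addbb !addbF.
Qed.

Lemma val_tflip k d (i : k.-tuple bool) : tflip d i = flip d i :> seq bool.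
Proof. by []. Qed.

Lemma arc_switch k p (u v : vertex k) : arc u v -> arc (switch p u) (switch p v).
Proof.
case: u => [[i j|i j|l q a|l q a b]|h|h t];
  case: v => [[i' j'|i' j'|l' q' c'|l' q' a' b']|h'|h' t'] //=.
- case/and3P=> /eqP q0 lk /eqP ->; rewrite q0 lk cflip_oversize //=.
  by rewrite nth_flip ?size_tuple // eqSS prefix0s andbT.
- case/andP=> /eqP q_i /eqP ->; rewrite q_i take_cflip eqxx.
  rewrite nth_cflip ?size_tuple //=.
  have [lp|_] := eqVneq (l' : nat) (size p); last exact: eqxx.
  have le_pi : size p <= size i by rewrite size_tuple -lp ltnW.
  by rewrite prefixE lp (size_takel le_pi) take_size [p == _]eq_sym.
- case/and3P=> /eqP -> lt_ql; rewrite size_cflip eqxx lt_ql /=.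
  rewrite !inE !xpair_eqE => /or3P[] /andP[/eqP -> /eqP ->].
  (* At [q = p] the switch exchanges the two children, which matches its exchange of [a] and [b];
     elsewhere the children keep their last bit. *)
  + rewrite cflip_rcons; have [q_p|n_qp] := eqVneq (q : seq bool) p.
      by rewrite q_p !prefix_rconsxx !andbF !addbF !eqxx ?orbT.
    by rewrite addbF !eqxx.
  + rewrite cflip_rcons; have [q_p|n_qp] := eqVneq (q : seq bool) p.
      by rewrite q_p !prefix_rconsxx !andbF !addbF !eqxx ?orbT.
    by rewrite addbF !eqxx !orbT.
  (* The edge to the pair at [q] itself survives because the twists of the two children add up to
     the twist at [q]. *)
  have -> : (l == size p :> nat) && prefix q p =
      ((l == size p :> nat) && prefix (rcons q false) p) (+)
      ((l == size p :> nat) && prefix (rcons q true) p).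
    by case: eqP => //= lp; rewrite prefix_addb // -lp.
  move: (_ && prefix (rcons q false) p) (_ && prefix (rcons q true) p) => ta tb.
  apply/or3P; apply: Or33; rewrite eqxx /=.
  by case: ifP => _; case: (ta); case: (tb); case: (a); case: (b).
(* [Hub] 2 tests bit 0 only, while the x are flipped at position [(size p).+1]. *)
- by rewrite nth_flip ?size_tuple ?addbF // (leq_ltn_trans _ (ltn_ord j')).
Qed.

Lemma cheap_switch k p (u v : vertex k) : cheap (switch p u) (switch p v) = cheap u v.
Proof.
have arcE x y : arc (switch p x) (switch p y) = arc x y.
  by apply/idP/idP => /(arc_switch p); rewrite ?switchK.
by rewrite /cheap !arcE.
Qed.

(** * Cells of stable partitions *)

Section Cells.
Variables (V : finType) (e : rel V) (pi : {set {set V}}).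
Hypothesis partP : partition pi [set: V].

Lemma same_cell_mem u v B : same_cell pi u v -> B \in pi -> (u \in B) = (v \in B).
Proof.
have /and3P[_ tiP _] := partP.
case/exists_inP => C Cpi /andP[uC vC] Bpi.
have [<-|nCB] := eqVneq C B; first by rewrite uC vC.
have dCB := trivIsetP tiP _ _ Cpi Bpi nCB.
by rewrite (disjointFr dCB uC) (disjointFr dCB vC).
Qed.

Lemma same_cell_refl u : same_cell pi u u.
Proof. by rewrite same_cellE // mem_pblock; have /and3P[/eqP -> _ _] := partP. Qed.

(** Pointwise form of being a union of cells, under which Boolean combinations are immediate. *)
Definition cell_invariant (A : {set V}) :=
  forall u v, same_cell pi u v -> (u \in A) = (v \in A).

Lemma cell_invariant_closed S : pi_closed pi S -> cell_invariant S.
Proof.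
case/existsP=> Q /andP[/subsetP sQ /eqP ->] u v uv.
by apply/bigcupP/bigcupP => -[B BQ xB]; exists B => //;
   move: xB; rewrite (same_cell_mem uv) ?sQ.
Qed.

Lemma same_cell_refine (R S : {set V}) u v : pi_closed pi S -> same_cell pi u v ->
    (u \in S -> forall R', R' \in pi -> R' \subset R ->
       #|nbh e u :&: R'| = #|nbh e v :&: R'|) ->
  same_cell (refine e pi R S) u v.
Proof.
move=> clS uv eq_uv; have SP := cell_invariant_closed clS.
have [uS|nuS] := boolP (u \in S); last first.
  case/exists_inP: (uv) => B Bpi /andP[uB vB].
  apply/exists_inP; exists B; last by rewrite uB.
  rewrite inE inE Bpi /=; apply/orP; left.
  apply/pred0P => x /=; apply/negP => /andP[xB xS]; case/negP: nuS.
  by rewrite (SP u x) //; apply/exists_inP; exists B => //; apply/andP.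
apply/exists_inP; exists [set x in S | refine_rel e pi R u x].
  by apply/setUP; right; apply: imset_f.
rewrite !inE uS -(SP _ _ uv) uS /refine_rel same_cell_refl uv /=.
apply/andP; split; first by apply/forall_inP=> R' _; apply/implyP.
by apply/forall_inP=> R' R'pi; apply/implyP => sR'; apply/eqP/eq_uv.
Qed.

Lemma cell_invariantC A : cell_invariant A -> cell_invariant (~: A).
Proof. by move=> iA u v /iA uv; rewrite !inE uv. Qed.

Lemma cell_invariantI A B :
  cell_invariant A -> cell_invariant B -> cell_invariant (A :&: B).
Proof. by move=> iA iB u v uv; rewrite !inE (iA _ _ uv) (iB _ _ uv). Qed.

Lemma cell_invariantT : cell_invariant [set: V].
Proof. by move=> u v _; rewrite !inE. Qed.

Hypothesis stP : stable e pi.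

(** An invariant set is a disjoint union of cells, so the counts that stability equates cell by cell
    add up. *)
Lemma card_nbh_invariant A u v : cell_invariant A -> same_cell pi u v ->
  #|nbh e u :&: A| = #|nbh e v :&: A|.
Proof.
move=> iA uv; have /and3P[/eqP cov tiP _] := partP.
have cardE x : #|nbh e x :&: A| =
    \sum_(B in pi) #|nbh e x :&: B| * (B \subset A).
  rewrite -sum1_card; under eq_bigl => y do rewrite -[_ \in _]andTb -[true](in_setT y).
  rewrite -[in LHS]cov big_trivIset_cond //; apply: eq_bigr => B Bpi.
  have [sBA|/subsetPn[z zB zA]] := boolP (B \subset A).
    rewrite muln1 -sum1_card; apply: eq_bigl => y; rewrite !inE andbC.
    by case: (boolP (y \in B)) => [/(subsetP sBA)->|]; rewrite ?andbT ?andbF.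
  rewrite muln0 big1 // => y; rewrite !inE => /and3P[yB _ yA].
  case/negP: zA; rewrite (iA z y) //.
  by apply/exists_inP; exists B => //; apply/andP.
rewrite !cardE; apply: eq_bigr => B Bpi; congr (_ * _).
have /forallP/(_ u)/forallP/(_ v)/implyP/(_ uv)/forall_inP/(_ B Bpi)/eqP := stP.
by [].
Qed.

Lemma cell_invariant_card (P : pred nat) A : cell_invariant A ->
  cell_invariant [set u | P #|nbh e u :&: A|].
Proof. by move=> iA u v uv; rewrite !inE (card_nbh_invariant iA uv). Qed.

Lemma cell_invariant_exists A : cell_invariant A ->
  cell_invariant [set u | [exists v in A, e u v]].
Proof.
move=> /(@cell_invariant_card (fun n => n != 0)) iA u v uv; move: (iA u v uv).
rewrite !inE !cards_eq0 => E; suff F w : [exists x in A, e w x] = (nbh e w :&: A != set0).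
  by rewrite !F.
apply/exists_inP/set0Pn => [[x xA wx]|[x]]; first by exists x; rewrite !inE wx.
by rewrite !inE => /andP[wx xA]; exists x.
Qed.

Lemma cell_invariant_forall A : cell_invariant A ->
  cell_invariant [set u | [forall v in A, e u v]].
Proof.
move=> iA u v uv; rewrite !inE.
have F w : [forall x in A, e w x] = (#|nbh e w :&: A| == #|A|).
  apply/forall_inP/eqP => [wA|eqA x xA].
    by congr #|pred_of_set _|; apply/setIidPr/subsetP=> x /wA; rewrite inE.
  have /eqP EA : nbh e w :&: A == A by rewrite eqEcard subsetIr eqA /=.
  by move: xA; rewrite -EA !inE => /andP[].
by rewrite !F (card_nbh_invariant iA uv).
Qed.

End Cells.

(** * Partitions invariant under switches *)

Lemma cflip_id p s : take (size p) s != p -> cflip p s = s.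
Proof.
elim: p s => [|a p IHp] [|b s] //=; rewrite /cflip -/cflip eqseq_cons [b == a]eq_sym.
by case: eqP => // _ /IHp ->.
Qed.

Lemma size_tprefix k d (i : k.-tuple bool) : size (take d i) <= k.
Proof. by rewrite size_take_min size_tuple geq_minr. Qed.

Definition tprefix k d (i : k.-tuple bool) : k.-bseq bool := Bseq (size_tprefix d i).

Lemma tcflip_prefix k d (i : k.-tuple bool) : tcflip (tprefix d i) i = tflip d i.
Proof. by apply: val_inj; apply: cflip_take. Qed.

Lemma tflip_oversize k d (i : k.-tuple bool) : k <= d -> tflip d i = i.
Proof. by move=> le_kd; apply: val_inj; apply: flip_oversize; rewrite size_tuple. Qed.

(** The bits from position [n] on are corrected one at a time from left to right; a later flip
    leaves the corrected bits intact. *)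
Lemma flip_connected k n (P : k.-tuple bool -> Prop) (i i' : k.-tuple bool) :
    (forall i0 d, n <= d < k -> P i0 -> P (tflip d i0)) ->
  take n i = take n i' -> P i -> P i'.
Proof.
move=> Pflip eq_n Pi.
have step m : n + m <= k -> exists2 i0, P i0 & take (n + m) i0 = take (n + m) i'.
  elim: m => [|m IHm] le_k; first by exists i; rewrite ?addn0.
  rewrite addnS in le_k *; have [i0 Pi0 eq0] := IHm (ltnW le_k).
  have takeS (s : k.-tuple bool) :
      take (n + m).+1 s = rcons (take (n + m) s) (nth false s (n + m)).
    by rewrite (take_nth false) // size_tuple.
  have [eqb|neqb] := eqVneq (nth false i0 (n + m)) (nth false i' (n + m)).
    by exists i0; rewrite // !takeS eq0 eqb.
  exists (tflip (n + m) i0); first by apply: Pflip; rewrite // leq_addr.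
  rewrite !takeS val_tflip take_flip // eq0 nth_flip ?size_tuple // eqxx addbT.
  by congr rcons; move: neqb; do 2!case: nth.
have [le_nk|lt_kn] := leqP n k; last first.
  move: eq_n; rewrite !take_oversize ?size_tuple ?(ltnW lt_kn) // => eq_i.
  by rewrite -(val_inj eq_i).
have [i0 Pi0] := step (k - n) (eq_leq (subnKC le_nk)).
by rewrite subnKC // !take_oversize ?size_tuple // => /val_inj <-.
Qed.

Lemma card_same_prefix k n (i : k.-tuple bool) : n <= k ->
  2 ^ (k - n) <= #|[set i' : k.-tuple bool | take n i' == take n i]|.
Proof.
move=> le_nk.
have szP (s : (k - n).-tuple bool) : size (take n i ++ s) == k.
  by rewrite size_cat size_takel size_tuple // subnKC.
have gI : injective (fun s => Tuple (szP s)).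
  by move=> s s' /(congr1 val) /= /eqP; rewrite eqseq_cat // eqxx => /eqP/val_inj.
rewrite -[2]card_bool -card_tuple -(card_imset predT gI); apply: subset_leq_card.
apply/subsetP=> _ /imsetP[s _ ->]; rewrite inE take_size_cat //.
by rewrite size_takel // size_tuple.
Qed.

Definition cross_degree k (u : vertex k) (A : {set vertex k}) : nat :=
  match u with
  | X i _ => #|[set j | Y i j \in A]|
  | Y i _ => #|[set j | X i j \in A]|
  | _ => 0
  end.

(** Separates the edges that the switches preserve from the expensive ones, which alone can tell a
    vertex from its switched copy. *)
Lemma card_nbh_adj k (u : vertex k) A :
  #|nbh (@adj k) u :&: A| = #|nbh (@cheap k) u :&: A| + cross_degree u A.
Proof.
have YI i : injective (fun j : 'I_k => Y i j) by move=> j j' [].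
have XI i : injective (fun j : 'I_k => X i j) by move=> j j' [].
have [B eqB ->] : exists2 B, B = [set v in A | cross u v || cross v u] &
    cross_degree u A = #|B|.
  eexists; first by [].
  case: u => [[i j|i j|l q c|l q a b]|h|h t] /=; last first.
  - by apply/esym/eq_card0 => -[[]|[]|[]] *; rewrite inE /= ?andbF.
  - by apply/esym/eq_card0 => -[[]|[]|[]] *; rewrite inE /= ?andbF.
  - by apply/esym/eq_card0 => -[[]|[]|[]] *; rewrite inE /= ?andbF.
  - by apply/esym/eq_card0 => -[[]|[]|[]] *; rewrite inE /= ?andbF.
  - rewrite -(card_imset _ (XI i)); apply: eq_card => v; rewrite inE.
    apply/imsetP/andP => [[j' vA ->]|]; first by move: vA; rewrite inE /= eqxx ?orbT.
    case=> vA; case: v vA => [[i' j'||l q c|l q a b]|h|h t] //= vA /eqP ii.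
    by exists j'; rewrite ?inE -ii.
  - rewrite -(card_imset _ (YI i)); apply: eq_card => v; rewrite inE.
    apply/imsetP/andP => [[j' vA ->]|]; first by move: vA; rewrite inE /= eqxx ?orbT.
    case=> vA; case: v vA => [[|i' j'|l q c|l q a b]|h|h t] //=; rewrite orbF => vA /eqP ii.
    by exists j'; rewrite ?inE ii.
rewrite -cardsUI [c in _ + c]eq_card0 ?addn0 => [|v]; last first.
  by rewrite eqB !inE /cheap; case: u v {B eqB} => [[i j|i j|l q c|l q a b]|h|h t];
    case=> [[i' j'|i' j'|l' q' c'|l' q' a' b']|h'|h' t'] /=; rewrite ?andbF.
by apply: eq_card => v; rewrite eqB !inE /adj; case: (v \in A); rewrite ?andbT ?andbF.
Qed.

Lemma card_cheap_switch k p (u : vertex k) (A : {set vertex k}) :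
    (forall v, (switch p v \in A) = (v \in A)) ->
  #|nbh (@cheap k) (switch p u) :&: A| = #|nbh (@cheap k) u :&: A|.
Proof.
move=> Asig; rewrite -[RHS](card_imset _ (can_inj (@switchK k p))).
apply: eq_card => v; apply/idP/imsetP => [|[w]].
  rewrite !inE => /andP[uv vA]; exists (switch p v); last by rewrite switchK.
  by rewrite !inE Asig vA andbT -(cheap_switch p) switchK.
by rewrite !inE => /andP[uw wA] ->; rewrite cheap_switch Asig uw.
Qed.

(* The words p for which no cell can yet separate a vertex from its switched copy;
   U is the set of words of length l that are not paid for yet. *)
Definition movable k l (U : {set k.-bseq bool}) (p : k.-bseq bool) :=
  (l < size p < k) || (p \in U).

(** The invariant of the potential argument. The first two clauses keep all [k] copies of a word
    together, whence the factor [k ^ 2] in the threshold for charges. *)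
Definition coarse k l (U : {set k.-bseq bool}) (pi : {set {set vertex k}}) :=
  [/\ forall i j j', same_cell pi (X i j) (X i j'),
      forall i j j', same_cell pi (Y i j) (Y i j') &
      forall p u, movable l U p -> same_cell pi u (switch p u)].

Definition charge k l (p : k.-bseq bool) (R S : {set vertex k}) :=
  #|[set t : k.-tuple bool * 'I_k * 'I_k |
     [&& take l t.1.1 == p :> seq bool, X t.1.1 t.1.2 \in R & Y t.1.1 t.2 \in S]]|.

(** For [p] of length [l], the threshold is the number of cross edges over the words that extend [p]
    by one fixed bit: [2 ^ (k - l.+1)] words with [k ^ 2] edges each. *)
Definition uncharged k l (U : {set k.-bseq bool}) R S :=
  [set p in U | charge l p R S < 2 ^ (k - l.+1) * k ^ 2].

(** * Effect of one refining operation on a coarse partition *)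

Section Coarse.
Variables (k l : nat) (U : {set k.-bseq bool}) (pi : {set {set vertex k}}).
Hypothesis lk : l < k.
Hypothesis U_level : forall p, p \in U -> size p = l.
Hypothesis U_neq0 : U != set0.
Hypothesis coarse_pi : coarse l U pi.

(** The switch for [p] flips bit [(size p).+1] of all the x at once, so any one movable word of
    length [d.-1] will do; at length [l] the nonempty [U] supplies it. *)
Lemma same_cell_flipX i j d : l < d -> same_cell pi (X i j) (X (tflip d i) j).
Proof.
case: coarse_pi => tX _ sg; case: d => // d le_ld.
have [lt_dk|le_kd] := ltnP d.+1 k; last by rewrite tflip_oversize.
have [p mp <-] : exists2 p, movable l U p & size p = d; last exact: sg.
move: le_ld; rewrite ltnS leq_eqVlt => /orP[/eqP <-|lt_ld].
  have /set0Pn[p pU] := U_neq0; exists p; last exact: U_level.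
  by rewrite /movable pU orbT.
have sz : size (tprefix d i) = d by rewrite size_takel // size_tuple ltnW // ltnW.
by exists (tprefix d i); rewrite // /movable sz lt_ld ltnW.
Qed.

(** A switch moves only the y below its word, so here the word has to be the prefix of [i] itself;
    hence the condition at [d = l]. *)
Lemma same_cell_flipY i j d : l < d \/ d = l /\ tprefix l i \in U ->
  same_cell pi (Y i j) (Y (tflip d i) j).
Proof.
case: coarse_pi => _ tY sg ld.
have [lt_dk|le_kd] := ltnP d k; last by rewrite tflip_oversize.
rewrite -tcflip_prefix; apply: (sg (tprefix d i) (Y i j)).
rewrite /movable size_takel ?size_tuple ?(ltnW lt_dk) // lt_dk andbT.
by case: ld => [->|[-> ->]]; rewrite ?orbT.
Qed.
Hypothesis partP : partition pi [set: vertex k].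

(** One x and one y below [p] suffice: flips beyond position [l] spread the x over all words that
    share the first [l.+1] bits of [i'], and flips from position [l] on spread the y over all words
    below [p]. *)
Lemma charge_full (p : k.-bseq bool) (R S : {set vertex k}) (i i' : k.-tuple bool) j j' :
    cell_invariant pi R -> cell_invariant pi S -> p \in U ->
    take l i = p -> take l i' = p -> X i' j' \in R -> Y i j \in S ->
  2 ^ (k - l.+1) * k ^ 2 <= charge l p R S.
Proof.
move=> iR iS pU ip i'p XR YS; have [tX tY _] := coarse_pi.
apply: (@leq_trans #|setX (setX [set i0 : k.-tuple bool | take l.+1 i0 == take l.+1 i']
   [set: 'I_k]) [set: 'I_k]|).
  by rewrite !cardsX cardsT card_ord -mulnA leq_mul2r card_same_prefix ?orbT.
apply: subset_leq_card; apply/subsetP=> -[[i0 j1] j2].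
rewrite !inE !andbT /= => /eqP i0i'.
have i0p : take l i0 = p.
  by rewrite -(take_takel _ (leqnSn l)) i0i' take_takel.
apply/and3P; split; first exact/eqP.
  rewrite (iR _ (X i0 j')) //.
  apply: (@flip_connected k l.+1 (fun i1 => X i1 j' \in R) i' i0) => // i1 d /andP[ld _].
  by rewrite (iR _ _ (same_cell_flipX i1 j' ld)).
rewrite (iS _ (Y i0 j)) //.
suff [] : Y i0 j \in S /\ take l i0 = p by [].
apply: (@flip_connected k l (fun i1 => Y i1 j \in S /\ take l i1 = p) i i0).
- move=> i1 d /andP[ld _] [i1S i1p]; rewrite val_tflip take_flip // i1p; split=> //.
  rewrite -(iS _ _ (same_cell_flipY (i := i1) j _)) //.
  move: ld; rewrite leq_eqVlt => /orP[/eqP<-|]; [right | by left].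
  by split=> //; congr (_ \in U): pU; apply: val_inj.
- by rewrite ip.
by [].
Qed.

(** Cheap degrees cannot separate a vertex from its switched copy, and cross degrees can do so only
    for a y below some [p] in [U], at the price of charging [p]. *)
Lemma coarse_refine (R S : {set vertex k}) : pi_closed pi R -> pi_closed pi S ->
  coarse l (uncharged l U R S) (refine (@adj k) pi R S).
Proof.
move=> clR clS; have [tX tY sg] := coarse_pi.
have iR := cell_invariant_closed partP clR; have iS := cell_invariant_closed partP clS.
have nX i j j' : nbh (@adj k) (X i j) = nbh (@adj k) (X i j').
  by apply/setP=> -[[]|[]|[]] *; rewrite !inE.
have nY i j j' : nbh (@adj k) (Y i j) = nbh (@adj k) (Y i j').
  by apply/setP=> -[[]|[]|[]] *; rewrite !inE.
split=> [i j j'|i j j'|p u mp].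
- by apply: same_cell_refine => // _ B _ _; rewrite (nX i j j').
- by apply: same_cell_refine => // _ B _ _; rewrite (nY i j j').
have mpU : movable l U p.
  by case/orP: mp => [lp|]; rewrite /movable ?lp // inE => /andP[->]; rewrite orbT.
have le_lp : l <= size p by case/orP: mpU => [/andP[/ltnW]|/U_level ->].
apply: same_cell_refine => // [|uS B Bpi sBR]; first exact: sg.
have iB : cell_invariant pi B by move=> v w vw; apply: same_cell_mem vw Bpi.
rewrite !card_nbh_adj card_cheap_switch => [|v]; last by rewrite -(iB _ _ (sg p v mpU)).
(* Only an x or a y has cross edges. For an x, the y in [B] may be flipped at position
   [(size p).+1], which exceeds [l]. *)
congr (_ + _); case: u uS => [[i j|i j|l' q c|l' q a b]|h|h t] //= uS.
  apply: eq_card => j'; rewrite !inE; apply: iB; apply: same_cell_flipY.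
  by left; rewrite ltnS.
(* A y whose word does not extend [p] is fixed by the switch. *)
have [ip|nip] := eqVneq (take (size p) i) p; last first.
  by rewrite (_ : tcflip p i = i) //; apply: val_inj; apply: cflip_id.
have pE : p = tprefix (size p) i by apply: val_inj.
rewrite [in RHS]pE tcflip_prefix.
move: mp; rewrite /movable inE => /orP[/andP[lp _]|/andP[pU]].
  by apply: eq_card => j'; rewrite !inE; apply: iB; apply: same_cell_flipX.
have lp := U_level pU; rewrite lp in ip *; rewrite ltnNge => /negP nch.
(* If either count were nonzero, [R] would contain an x below [p], and with the given y in [S] this
   would charge [p]; so both counts vanish. *)
rewrite !eq_card0 // => j'; rewrite !inE; apply/negP => XB; apply: nch.
- apply: (charge_full iR iS pU ip _ _ uS); last exact: subsetP sBR _ XB.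
  by rewrite val_tflip take_flip.
- by apply: (charge_full iR iS pU ip ip _ uS); apply: subsetP sBR _ XB.
Qed.

End Coarse.

(** * Stable partitions of the graph *)

Lemma exists_extension k (p : k.-bseq bool) :
  exists i : k.-tuple bool, take (size p) i = p.
Proof.
have sz : size (p ++ nseq (k - size p) false) == k.
  by rewrite size_cat size_nseq subnKC ?size_bseq.
by exists (Tuple sz); rewrite /= take_size_cat.
Qed.

Lemma card_vertex_set k (A : {set vertex k}) :
  #|A| = #|[set u | Core u \in A]| +
    (#|[set h | Hub k h \in A]| + \sum_(h < 3) #|[set t | Fill h t \in A]|).
Proof.
have bij : bijective (@vertex_decode k).
  by exists (@vertex_code k); [case=> [|[|[]]] | exact: vertex_codeK].
rewrite -sum1_card (reindex _ (onW_bij _ bij)) /= big_sumType big_sumType /=.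
congr (_ + (_ + _)); rewrite -?sum1_card; try by apply: eq_bigl => ?; rewrite inE.
under [RHS]eq_bigr do rewrite -sum1_card.
rewrite pair_big_dep; apply: eq_bigl => -[h t] /=.
by rewrite inE.
Qed.

Section Stable.
Variables (k : nat) (pi : {set {set vertex k}}).
Hypothesis partP : partition pi [set: vertex k].
Hypothesis stP : stable (@adj k) pi.
Local Notation inv := (cell_invariant pi).

Definition Xset (P : pred (k.-tuple bool)) : {set vertex k} :=
  [set u | if u is X i _ then P i else false].
Definition Yset (P : pred (k.-tuple bool)) : {set vertex k} :=
  [set u | if u is Y i _ then P i else false].

Lemma invariant_eq (A B : {set vertex k}) : inv A -> A =i B -> inv B.
Proof. by move=> iA AB u v uv; rewrite -!AB; apply: iA. Qed.

Lemma invariant_adj w : inv [set w] -> inv [set u | adj u w].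
Proof.
move/(cell_invariant_exists partP stP)/invariant_eq; apply=> u; rewrite !inE.
apply/exists_inP/idP => [[v]|uw]; first by rewrite inE => /eqP->.
by exists w; rewrite ?inE.
Qed.

(** A block of fillers outnumbers the core and the three hubs together, hence the 4; so the quotient
    counts the filler blocks joined to [u]. *)
Lemma degree_hub (u : vertex k) :
  #|nbh (@adj k) u| %/ (#|{: core k}| + 4) = if u is Hub h then h.+1 else 0.
Proof.
rewrite card_vertex_set; set a := #|_|; set b := #|_|; set c := \sum_(_ < _) _.
have aN : a <= #|{: core k}| by apply: max_card.
have bN : b <= 3 by apply: leq_trans (max_card _) _; rewrite card_ord.
have small : c = 0 -> (a + (b + c)) %/ (#|{: core k}| + 4) = 0.
  by move=> ->; rewrite divn_small //; lia.
case: u @a @b @c aN bN small => [u|h|h t] a b c aN bN small.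
- by apply: small; apply: big1 => h _; apply/eqP; rewrite cards_eq0; apply/eqP/setP=> t;
    rewrite !inE /adj /cheap /=; case: u {a b c aN bN}.
- have -> : b = 0.
    by apply/eqP; rewrite cards_eq0; apply/eqP/setP=> h'; rewrite !inE.
  have -> : c = h.+1 * (#|{: core k}| + 4).
    have cE h' : #|[set t | Fill h' t \in nbh (adj (k:=k)) (Hub k h)]| =
        (h' <= h) * (#|{: core k}| + 4).
      have -> : [set t | Fill h' t \in nbh (@adj k) (Hub k h)] = [set t | h' <= h].
        by apply/setP=> t; rewrite !inE /adj /cheap /= !orbF.
      case: (h' <= h) => /=; last by rewrite mul0n; apply/eq_card0 => t; rewrite inE.
      by rewrite mul1n -[RHS]card_ord; apply: eq_card => t; rewrite inE.
    rewrite /c; under eq_bigr do rewrite cE.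
    rewrite !big_ord_recl big_ord0; case: h {a b c aN bN small cE} => [[|[|[|]]]] //= _; lia.
  by rewrite add0n addnC divnMDl ?divn_small; lia.
- apply: small; apply: big1 => h' _; apply/eqP; rewrite cards_eq0; apply/eqP/setP=> t'.
  by rewrite !inE.
Qed.

Lemma invariant_hub h : inv [set Hub k h].
Proof.
have := cell_invariant_card partP stP (fun n => n %/ (#|{: core k}| + 4) == h.+1)
  (@cell_invariantT _ pi).
move/invariant_eq; apply=> u; rewrite !inE setIT degree_hub.
by case: u => [u|h'|h' t]; rewrite // eqSS.
Qed.

(** [Hub] 0 sees the x and some fillers; these fillers are joined to the next hub as well, which the
    x are not. The y are isolated in the same way from [Hub] 1 and [Hub] 2. *)
Lemma invariant_X : inv (Xset xpredT).
Proof.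
apply: (invariant_eq (cell_invariantI (invariant_adj (invariant_hub (@Ordinal 3 0 isT)))
  (cell_invariantC (invariant_adj (invariant_hub (@Ordinal 3 1 isT)))))).
case=> [[i j|i j|l q c|l q a b]|h|h t]; rewrite !inE /adj /cheap /= ?orbF ?orbT //.
by case: h => [[]].
Qed.

Lemma invariant_Y : inv (Yset xpredT).
Proof.
apply: (invariant_eq (cell_invariantI (invariant_adj (invariant_hub (@Ordinal 3 1 isT)))
  (cell_invariantC (invariant_adj (invariant_hub (@Ordinal 3 2 isT)))))).
case=> [[i j|i j|l q c|l q a b]|h|h t]; rewrite !inE /adj /cheap /= ?orbF ?orbT //.
by case: h => [[|[|[|]]]].
Qed.

Lemma invariant_XI P Q : inv (Xset P) -> inv (Xset Q) -> inv (Xset (predI P Q)).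
Proof.
move=> iP iQ; apply: (invariant_eq (cell_invariantI iP iQ)).
by case=> [[i j|i j|l q c|l q a b]|h|h t]; rewrite !inE.
Qed.

(** The only x adjacent to a y are those over its own word. *)
Lemma invariant_YX P : inv (Xset P) -> inv (Yset P).
Proof.
move=> /(cell_invariant_exists partP stP) iP.
apply: (invariant_eq (cell_invariantI invariant_Y iP)).
case=> [[i j|i j|l q c|l q a b]|h|h t]; rewrite !inE //=.
apply/exists_inP/idP => [[v]|Pi].
  case: v => [[i' j'|i' j'|l q c|l q a b]|h|h t]; rewrite ?inE // => Pi'.
  by rewrite /adj /cheap /= => /eqP<-.
by exists (X i j); rewrite ?inE // /adj /cheap /= eqxx.
Qed.

(** Outside the x, [W l q c] is the only vertex joined to all the y whose word begins with
    [rcons q c] and to no other y. The x are excluded because for [l.+1 = k] those over that word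
    see the same y. *)
Lemma invariant_leaf (l : 'I_k) (q : k.-bseq bool) c : size q = l ->
  inv (Yset (fun i => take l.+1 i == rcons q c)) -> inv [set W l q c].
Proof.
move=> szq iP; set P := fun i : k.-tuple bool => _ in iP.
have iNP : inv (Yset (predC P)).
  apply: (invariant_eq (cell_invariantI invariant_Y (cell_invariantC iP))).
  by case=> [[i j|i j|l' q' c'|l' q' a b]|h|h t]; rewrite !inE.
apply: (invariant_eq (cell_invariantI (cell_invariantC invariant_X)
  (cell_invariantI (cell_invariant_forall partP stP iP)
    (cell_invariantC (cell_invariant_exists partP stP iNP))))).
have szp : size (rcons q c) <= k by rewrite size_rcons szq.
have [i0] := exists_extension (Bseq szp); rewrite /= size_rcons szq => i0p.
have takeS (s : k.-tuple bool) : take l.+1 s = rcons (take l s) (nth false s l).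
  by rewrite (take_nth false) // size_tuple.
have /rcons_inj[i0q i0c] : rcons (take l i0) (nth false i0 l) = rcons q c.
  by rewrite -takeS.
have Pi0 : P i0 by apply/eqP.
(* Test words: a flip of [i0] at a position up to [l] leaves [P], a flip beyond [l] stays in [P]. A
   pair of another level [l'] is ruled out by the flip at [l] if [l' < l], and by the flip at [l']
   otherwise. *)
have Pf d : d <= l -> P (tflip d i0) = false.
  move=> dl; apply/negbTE/eqP; rewrite -i0p.
  move/(congr1 (fun s => nth false s d)); rewrite !nth_take // val_tflip.
  rewrite nth_flip ?size_tuple ?(leq_ltn_trans dl) // eqxx addbT.
  by case: nth.
have Pt d : l < d -> P (tflip d i0).
  by move=> ld; rewrite /P val_tflip take_flip // i0p.
move=> u; rewrite !inE; apply/and3P/eqP => [[uX /forall_inP uP /exists_inPn uN]|->].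
  have uP' i j : P i -> adj u (Y i j) by move=> Pi; apply: uP; rewrite inE.
  have uN' i j : ~~ P i -> ~~ adj u (Y i j) by move=> Pi; apply: uN; rewrite inE.
  have adjYW i j l' q' c' :
      adj (W l' q' c') (Y i j) = (q' == take l' i :> seq bool) && (c' == nth false i l').
    by rewrite /adj /cheap /= !orbF.
  case: u uX uP uN uP' uN' => [[i j|i j|l' q' c'|l' q' a b]|h|h t] uX uP uN uP' uN'.
  - by case/negP: uX.
  - by have := uP' i0 l Pi0; rewrite /adj /cheap.
  - have := uP' i0 l Pi0; rewrite adjYW => /andP[/eqP q'i0 /eqP c'i0].
    have [ll|ll|/val_inj ll] := ltngtP l' l.
    + have := uN' (tflip l i0) l; rewrite Pf // => /(_ isT); case/negP.
      rewrite adjYW val_tflip take_flip ?(ltnW ll) // q'i0 eqxx c'i0.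
      by rewrite nth_flip ?size_tuple // (ltn_eqF ll) addbF eqxx.
    + have := uP' (tflip l' i0) l (Pt _ ll); rewrite adjYW => /andP[_].
      by rewrite nth_flip ?size_tuple // c'i0 eqxx addbT; case: nth.
    by subst l'; congr (W _ _ _); [apply: val_inj; rewrite /= q'i0 | rewrite c'i0].
  - by have := uP' i0 l Pi0; rewrite /adj /cheap.
  - have := uN' (tflip l i0) l; rewrite Pf // => /(_ isT).
    by have := uP' i0 l Pi0; rewrite /adj /cheap /= => ->.
  by have := uP' i0 l Pi0; rewrite /adj /cheap.
split; first by [].
  apply/forall_inP=> v; rewrite inE.
  case: v => [[i' j'|i' j'|l' q' c'|l' q' a b]|h|h t] //.
  rewrite /P takeS => /eqP/rcons_inj[iq ic].
  by rewrite /adj /cheap /= iq ic !eqxx.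
apply/exists_inPn=> v; rewrite inE.
case: v => [[i' j'|i' j'|l' q' c'|l' q' a b]|h|h t] //.
rewrite /= /P takeS /adj /cheap /= !orbF; apply: contra => /andP[/eqP<- /eqP<-] //.
Qed.

Lemma invariant_M (l : 'I_k) (q q0 q1 : k.-bseq bool) a b : size q < l ->
    q0 = rcons q false :> seq bool -> q1 = rcons q true :> seq bool ->
    inv [set W l q0 a] -> inv [set W l q1 b] ->
  inv [set M l q a b].
Proof.
move=> lt_ql q0E q1E i0 i1.
apply: (invariant_eq (cell_invariantI (invariant_adj i0) (invariant_adj i1))).
move=> u; rewrite !inE; apply/andP/eqP => [|->]; last first.
  by rewrite /adj /cheap /= q0E q1E lt_ql !inE !eqxx !orbT.
case: u => [[i j|i j|l' q' c|l' q' a' b']|h|h t]; rewrite /adj /cheap /= ?orbF.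
- by rewrite q0E; case: (bseqval q) => [|? ?] [].
- by rewrite q0E q1E => -[/andP[/eqP <- _] /andP[/eqP/rcons_inj[]]].
- by case.
- rewrite q0E q1E !inE !xpair_eqE.
  case=> /and3P[/eqP ll lt0] + /and3P[_ _]; case/or3P=> /andP[/eqP e0 /eqP ea];
    case/or3P=> /andP[/eqP e1 /eqP eb].
  all: try by move: (rcons_inj e0) => [].
  all: try by move: (rcons_inj e1) => [].
  + by case/rcons_inj: e0 => /val_inj ->; rewrite ll ea eb.
  + by move: (congr1 size e0) (congr1 size e1); rewrite !size_rcons; lia.
  + by move: (congr1 size e0) (congr1 size e1); rewrite !size_rcons; lia.
  by move: e0; rewrite -e1 => /rcons_inj.
- by case.
by case.
Qed.

(** Only [W l q c] is joined to both [M l q false c] and [M l q true (~~ c)]: each label has sum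
    [c], and the two labels differ at both children. *)
Lemma invariant_node (l : 'I_k) (q q0 q1 : k.-bseq bool) c : size q < l ->
    q0 = rcons q false :> seq bool -> q1 = rcons q true :> seq bool ->
    (forall a, inv [set W l q0 a]) -> (forall a, inv [set W l q1 a]) ->
  inv [set W l q c].
Proof.
move=> lt_ql q0E q1E i0 i1.
have iM a b : inv [set M l q a b] by apply: invariant_M q0E q1E _ _.
apply: (invariant_eq (cell_invariantI (invariant_adj (iM false c))
  (invariant_adj (iM true (~~ c))))).
move=> u; rewrite !inE; apply/andP/eqP => [|->]; last first.
  by rewrite /adj /cheap /= lt_ql !inE !eqxx /=; case: (c); rewrite eqxx !orbT.
case: u => [[i j|i j|l' q' c'|l' q' a' b']|h|h t]; rewrite /adj /cheap /= ?orbF; try by case.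
rewrite !inE !xpair_eqE => -[/and3P[/eqP <- _ qc] /and3P[_ _ qc']].
suff [-> ->] : q' = q /\ c' = c by [].
have neq d : (rcons q d == q :> seq bool) = false.
  by apply/eqP => /(congr1 size); rewrite size_rcons; lia.
have inj d d' : (rcons q d == rcons q d') = (d == d') by rewrite eqseq_rcons eqxx.
case/or3P: qc qc' => /andP[/eqP e /eqP ->]; rewrite e ?inj ?neq ?eqxx //=.
by case: c.
by rewrite (val_inj e).
Qed.

Lemma invariant_level (l : 'I_k) : (forall p, inv (Xset (fun i => take l.+1 i == p))) ->
  forall m (q : k.-bseq bool) c, size q + m = l -> inv [set W l q c].
Proof.
move=> iX; elim=> [|m IHm] q c szq.
  by apply: invariant_leaf; [rewrite -szq addn0 | apply/invariant_YX/iX].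
have sz d : size (rcons q d) <= k.
  by rewrite size_rcons; have := ltn_ord l; lia.
apply: (@invariant_node l q (Bseq (sz false)) (Bseq (sz true))) => // [|a|a]; first lia.
  by apply: IHm; rewrite /= size_rcons addSnnS.
by apply: IHm; rewrite /= size_rcons addSnnS.
Qed.

(** Bit 0 is read off [Hub] 2, and bit [n.+1] off the root pair of level [n], which the first [n.+1]
    bits of the x already split. *)
Lemma invariant_bit n c : n < k -> (forall p, inv (Xset (fun i => take n i == p))) ->
  inv (Xset (fun i => nth false i n == c)).
Proof.
have bitE (A : {set vertex k}) : inv A -> (forall i j, (X i j \in A) = (nth false i n == c)) ->
    inv (Xset (fun i => nth false i n == c)).
  move=> iA AE; apply: (invariant_eq (cell_invariantI invariant_X iA)).
  by case=> [[i j|i j|l q c'|l q a b]|h|h t]; rewrite !inE // AE.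
case: n bitE => [|n] bitE lt_nk iX.
  have iH := invariant_adj (invariant_hub (@Ordinal 3 2 isT)).
  case: c bitE => bitE; [apply: bitE (cell_invariantC iH) _ | apply: bitE iH _] => i j.
    by rewrite !inE /adj /cheap /= orbF negbK eqb_id.
  by rewrite !inE /adj /cheap /= orbF eqbF_neg.
have iW := @invariant_level (Ordinal (ltnW lt_nk)) iX n [bseq] c erefl.
apply: bitE (invariant_adj iW) _ => i j.
by rewrite !inE /adj /cheap /= lt_nk !orbF eq_sym.
Qed.

Lemma invariant_prefix n : n <= k -> forall p, inv (Xset (fun i => take n i == p)).
Proof.
elim: n => [|n IHn] lt_nk p.
  apply: (invariant_eq (A := if p is [::] then Xset xpredT else ~: setT)).
    by case: p => [|? ?]; [apply: invariant_X | apply/cell_invariantC/cell_invariantT].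
  by case: p => [|b p] u; rewrite !inE //; case: u => [[i j|i j|l q c|l q a d]|h|h t];
    rewrite // take0.
have iX := IHn (ltnW lt_nk).
case/lastP: p => [|p b].
  apply: (invariant_eq (cell_invariantC (@cell_invariantT _ pi))) => u; rewrite !inE.
  case: u => [[i j|i j|l q c|l q a d]|h|h t] //; apply/esym/negbTE/eqP.
  by move/(congr1 size); rewrite size_takel ?size_tuple.
apply: (invariant_eq (invariant_XI (iX p) (invariant_bit b lt_nk iX))).
case=> [[i j|i j|l q c|l q a d]|h|h t]; rewrite !inE //=.
by rewrite (take_nth false) ?size_tuple // eqseq_rcons.
Qed.

Lemma stable_discrete i i' j j' : same_cell pi (Y i j) (Y i' j') -> i = i'.
Proof.
move/(invariant_YX (invariant_prefix (leqnn k) i)); rewrite !inE !take_oversize ?size_tuple //.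
by rewrite eqxx => /esym/eqP/val_inj.
Qed.

End Stable.

(** * The potential *)

(** Words of the same length [l] have disjoint sets of cross edges below them. *)
Lemma sum_charge k l (U : {set k.-bseq bool}) (R S : {set vertex k}) :
  \sum_(p in U) charge l p R S <= op_cost (@adj k) R S.
Proof.
pose T := [set t : k.-tuple bool * 'I_k * 'I_k |
             (X t.1.1 t.1.2 \in R) && (Y t.1.1 t.2 \in S)].
apply: (@leq_trans #|T|).
  rewrite -[#|T|]sum1_card (partition_big (fun t => tprefix l t.1.1) predT) //=.
  rewrite [leqRHS](bigID (mem U)) /=; apply: leq_trans (leq_addr _ _).
  apply: leq_sum => p _; rewrite sum1_card; apply/eq_leq/eq_card => t.
  by rewrite [RHS]andbC -val_eqE !inE.
have fI : injective (fun t : k.-tuple bool * 'I_k * 'I_k =>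
    (X t.1.1 t.1.2, Y t.1.1 t.2)).
  by move=> [[i j1] j2] [[i' j1'] j2'] [-> -> _ ->].
rewrite -(card_imset _ fI); apply: subset_leq_card.
apply/subsetP=> _ /imsetP[[[i j1] j2] + ->]; rewrite !inE /= => /andP[-> ->].
by rewrite /adj /cheap /= eqxx.
Qed.

(** Cost still to come on level [l] with [u] unpaid words, plus [2 ^ k.-1 * k ^ 2] for each of the
    [k - l.+1] later levels. *)
Definition potential k l u :=
  u * (2 ^ (k - l.+1) * k ^ 2) + (k - l.+1) * (2 ^ k.-1 * k ^ 2).

Lemma card_level k l : l <= k -> 2 ^ l <= #|[set q : k.-bseq bool | size q == l]|.
Proof.
move=> le_lk; pose f (t : l.-tuple bool) := widen_bseq le_lk (bseq_of_tuple t).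
have fI : injective f by move=> s t /(congr1 (@bseqval _ _)) st; apply: val_inj.
rewrite -[2]card_bool -card_tuple -(card_imset predT fI); apply: subset_leq_card.
by apply/subsetP=> _ /imsetP[s _ ->]; rewrite inE; apply/eqP; apply: size_tuple.
Qed.

(** Below a word of [U], two y whose words differ in bit [l] share a cell, which a stable partition
    forbids. *)
Lemma coarse_not_stable k l (U : {set k.-bseq bool}) (pi : {set {set vertex k}}) :
    partition pi [set: vertex k] -> l < k -> (forall p, p \in U -> size p = l) ->
    U != set0 -> coarse l U pi ->
  ~~ stable (@adj k) pi.
Proof.
move=> partP lk szU U0 cpi; apply/negP => stP.
have [p pU] := set0Pn _ U0; have [i] := exists_extension p; rewrite szU // => ip.
have j : 'I_k := Ordinal lk.
have iU : tprefix l i \in U by congr (_ \in U): pU; apply: val_inj.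
have := same_cell_flipY cpi j (or_intror (conj erefl iU)).
move/(stable_discrete partP stP)/(congr1 (fun s : k.-tuple bool => nth false s l)).
by rewrite val_tflip nth_flip ?size_tuple // eqxx addbT; case: nth.
Qed.

(** The [2 ^ l.+1] words of the new level, worth [2 ^ (k - l.+2) * k ^ 2] each, make up the amount
    reserved for that level. *)
Lemma potential_next k l u : l.+1 < k -> 2 ^ l.+1 <= u ->
  potential k l 0 <= potential k l.+1 u.
Proof.
move=> lk le_u; rewrite /potential mul0n add0n.
have -> : k - l.+1 = (k - l.+2).+1 by lia.
rewrite mulSn leq_add2r mulnA leq_mul2r; apply/orP; right.
apply: leq_trans (leq_mul le_u (leqnn _)).
by rewrite -expnD leq_exp2l //; lia.
Qed.

Lemma potential_diff k l (U : {set k.-bseq bool}) (R S : {set vertex k}) :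
  potential k l #|U| <=
  potential k l #|uncharged l U R S| + op_cost (@adj k) R S.
Proof.
rewrite /potential addnAC leq_add2r; set w := _ * k ^ 2.
have sUU : uncharged l U R S \subset U by apply/subsetP=> p; rewrite inE => /andP[].
rewrite -(setIidPr sUU) -[#|U|](cardsID (uncharged l U R S) U) mulnDl leq_add2l.
apply: leq_trans (sum_charge l U R S).
rewrite [leqRHS](big_setID (uncharged l U R S)) /=; apply: leq_trans (leq_addl _ _).
rewrite -sum_nat_const; apply: leq_sum => p; rewrite !inE.
by case: (p \in U); rewrite ?andbF //= andbT -leqNgt.
Qed.

(** Induction on the number of cells still missing. An operation lowers the potential by at most its
    cost; when [U] is empty, the level moves up without any operation. *)
Lemma cost_coarse n k l (U : {set k.-bseq bool}) (pi : {set {set vertex k}}) :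
    partition pi [set: vertex k] -> #|{: vertex k}| - #|pi| < n -> l < k ->
    (forall p, p \in U -> size p = l) -> coarse l U pi ->
  potential k l #|U| <= cost (@adj k) pi.
Proof.
elim: n => [|n IHn] // in l U pi * => partP lt_n.
(* Stated for every level, since it serves level [l] and, once [U] is empty, level [l.+1] on the
   same partition. *)
have step l' (U' : {set k.-bseq bool}) :
    l' < k -> (forall p, p \in U' -> size p = l') -> coarse l' U' pi ->
    U' != set0 -> potential k l' #|U'| <= cost (@adj k) pi.
  move=> lk szU cpi U0; have nst := coarse_not_stable partP lk szU U0 cpi.
  have [_ [R [S [eff ->]]]] := costP partP nst.
  have [clR clS _] := and3P eff.
  have lt_card := effective_card partP eff.
  have part' := refine_partition (@adj k) R partP clS.
  have le_card := card_partition_le part'.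
  apply: leq_trans (potential_diff _ _ R S) _; rewrite leq_add2r.
  apply: IHn => //; [ | | exact: coarse_refine].
    apply: leq_trans (ltn_sub2l (leq_trans lt_card le_card) lt_card) _.
    by rewrite -ltnS.
  by move=> p; rewrite inE => /andP[/szU].
move=> lk szU cpi; have [U0|] := eqVneq U set0; last exact: step.
rewrite U0 cards0; have [lk1|] := ltnP l.+1 k; last first.
  by rewrite -subn_eq0 /potential => /eqP->.
have card1 := card_level (ltnW lk1).
apply: leq_trans (potential_next lk1 card1) _; apply: step => //.
- by move=> p; rewrite inE => /eqP.
(* Words of length [l.+1] are movable at level [l] by their length, and at level [l.+1] as members
   of the new set. *)
- rewrite U0 in cpi; case: cpi => tX tY sg; split=> // p u mp; apply: sg; move: mp.
  by rewrite /movable !inE orbF => /orP[/andP[/ltnW -> ->] //|/eqP ->]; rewrite ltnSn.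
by rewrite -card_gt0; apply: leq_trans card1; rewrite expn_gt0.
Qed.

Lemma coarse_unit k : coarse 0 [set [bseq] : k.-bseq bool] (unit_partition (vertex k)).
Proof.
have one u v : same_cell (unit_partition (vertex k)) u v.
  by apply/exists_inP; exists setT; rewrite ?inE.
by split=> *; apply: one.
Qed.

Lemma unit_partitionP (V : finType) : 0 < #|V| -> partition (unit_partition V) [set: V].
Proof.
move=> V0; rewrite /unit_partition /partition /trivIset cover1 big_set1 !eqxx inE.
by rewrite eq_sym -card_gt0 cardsT V0.
Qed.

Lemma cost_unit k : 0 < k ->
  k * (2 ^ k.-1 * k ^ 2) <= cost (@adj k) (unit_partition (vertex k)).
Proof.
move=> k0; have V0 : 0 < #|{: vertex k}|.
  by rewrite card_vertex; lia.
have := cost_coarse (unit_partitionP V0) (ltnSn _) k0 _ (coarse_unit k).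
rewrite cards1 /potential mul1n subn1 -mulSn prednK //; apply.
by move=> p; rewrite inE => /eqP->.
Qed.

(** * Size of the graph *)

(** 14 = 1 + 1 + 2 * 6: the x, the y, and six vertices for each of fewer than [2 * 2 ^ k] words on
    each of [k] levels. *)
Lemma card_core_le k : #|{: core k}| <= 14 * (2 ^ k * k).
Proof.
rewrite card_core.
have : (2 ^ k.+1).-1 <= 2 * 2 ^ k by rewrite -expnS leq_pred.
by move/(leq_mul (leqnn k)); move: (_.-1) => a; lia.
Qed.

Lemma leq_exp2k k : 2 <= k -> 8 <= 2 ^ k * k.
Proof. by move=> k2; rewrite -[8]/(4 * 2); apply: leq_mul => //; apply: (@leq_pexp2l 2 2). Qed.

Lemma card_vertex_le k : 2 <= k -> #|{: vertex k}| <= 58 * (2 ^ k * k).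
Proof. by move=> /leq_exp2k; rewrite card_vertex; have := card_core_le k; lia. Qed.

Lemma card_vertex_ge k : 2 ^ k * k <= #|{: vertex k}|.
Proof. by rewrite card_vertex card_core -!addnA leq_addr. Qed.

Lemma card_rel (T : finType) (r : rel T) :
  #|[set p : T * T | r p.1 p.2]| = \sum_x #|[set y | r x y]|.
Proof.
rewrite -sum1_card; under [RHS]eq_bigr do rewrite -sum1_card.
by rewrite pair_big_dep; apply: eq_bigl => p; rewrite !inE.
Qed.

(** Each edge is counted at the end that [arc] or [cross] leaves: at most [2 * k] at an x, [k] at a
    y, 3 at an inner gadget vertex and none at a pair, however large its degree. *)
Lemma outdegree_core k (u : core k) :
  #|[set v | arc (Core u) v || cross (Core u) v]| <= 3 * k.
Proof.
have bound (s : seq (vertex k)) : size s <= 3 * k ->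
    (forall v, arc (Core u) v || cross (Core u) v -> v \in s) ->
    #|[set v | arc (Core u) v || cross (Core u) v]| <= 3 * k.
  move=> ss sP; apply: leq_trans ss; apply: leq_trans (card_size s).
  by apply: subset_leq_card; apply/subsetP=> v; rewrite inE; apply: sP.
case: u bound => [i j|i j|l q c|l q a b] bound.
- apply: (bound ([seq W l [bseq] (nth false i l.+1) | l : 'I_k] ++
                 [seq Y i j' | j' : 'I_k])) => [|v].
    by rewrite size_cat !size_map -enumT size_enum_ord; lia.
  rewrite mem_cat; case: v => [[i' j'|i' j'|l q c|l q a b]|h|h t] //=.
    by move=> /eqP<-; apply/orP; right; apply/imageP; exists j'.
  rewrite orbF => /and3P[/eqP q0 _ /eqP->]; apply/orP; left; apply/imageP.
  by exists l => //; congr (W _ _ _); apply: val_inj.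
- apply: (bound [seq W l (tprefix l i) (nth false i l) | l : 'I_k]) => [|v].
    by rewrite size_map size_enum_ord; lia.
  case: v => [[i' j'|i' j'|l q c|l q a b]|h|h t] //=.
  rewrite orbF => /andP[/eqP ql /eqP->]; apply/imageP.
  by exists l => //; congr (W _ _ _); apply: val_inj.
- by apply: (bound [::]) => // -[[]|[]|[]].
apply: (bound [:: W l (insub_bseq k (rcons q false)) a;
  W l (insub_bseq k (rcons q true)) b; W l q (a (+) b)]) => [|v].
  by have := ltn_ord l; rewrite /=; lia.
case: v => [[i' j'|i' j'|l' q' c|l' q' a' b']|h|h t] //=; rewrite orbF.
case/and3P=> /eqP -> _; rewrite !inE !xpair_eqE.
have iE : q' = insub_bseq k q' by rewrite /insub_bseq valKd.
case/or3P=> /andP[/eqP e /eqP ->]; apply/or3P.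
- by apply: Or31; rewrite -e -iE.
- by apply: Or32; rewrite -e -iE.
by apply: Or33; rewrite (val_inj e).
Qed.

(** The core gives 14 * 3 = 42. The hubs give 3 * 58 = 174 times [2 ^ k * k], which is at most 87
    times [2 ^ k * k ^ 2] as [2 <= k]. *)
Lemma card_edges_le k : 2 <= k -> #|edges (@adj k)| <= 130 * (2 ^ k * k ^ 2).
Proof.
move=> k2; pose r (u v : vertex k) := arc u v || cross u v.
apply: (@leq_trans #|[set p : vertex k * vertex k | r p.1 p.2]|).
  apply: leq_trans (leq_imset_card (fun p => [set p.1; p.2]) _).
  apply: subset_leq_card; apply/subsetP=> _ /imsetP[[u v] + ->].
  rewrite inE /= /adj /cheap => uv.
  have [ruv|] := boolP (r u v); first by apply/imsetP; exists (u, v); rewrite ?inE.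
  rewrite /r negb_or => /andP[/negPf auv /negPf cuv].
  rewrite auv cuv /= in uv; apply/imsetP; exists (v, u); rewrite ?inE //=.
  by rewrite setUC.
rewrite card_rel.
have bij : bijective (@vertex_decode k).
  by exists (@vertex_code k); [case=> [|[|[]]] | exact: vertex_codeK].
rewrite (reindex _ (onW_bij _ bij)) /= !big_sumType /=.
set a := \sum_(_ : core k) _; set b := \sum_(_ : 'I_3) _; set c := \sum_(_ : _ * _) _.
have -> : c = 0.
  by apply: big1 => -[h t] _; apply/eqP; rewrite cards_eq0; apply/eqP/setP=> v; rewrite inE.
have : a <= #|{: core k}| * (3 * k).
  by rewrite -sum_nat_const; apply: leq_sum => u _; apply: outdegree_core.
have : b <= 3 * #|{: vertex k}|.
  rewrite -[3]card_ord -sum_nat_const; apply: leq_sum => h _; apply: max_card.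
have := card_vertex_le k2; have := card_core_le k; have := leq_mul (leqnn (2 ^ k * k)) k2.
have -> : 2 ^ k * k ^ 2 = 2 ^ k * k * k by rewrite -mulnA.
move: (2 ^ k * k) #|_| #|_| => w v u; nia.
Qed.

Lemma card_edges_ge k : 2 ^ k * k ^ 2 <= #|edges (@adj k)|.
Proof.
pose f (t : k.-tuple bool * 'I_k * 'I_k) : {set vertex k} :=
  [set X t.1.1 t.1.2; Y t.1.1 t.2].
have fI : injective f.
  move=> [[i j] h] [[i' j'] h'] /setP E.
  have := E (X i j); rewrite !inE /= eqxx => /esym/orP[] /eqP // [-> ->].
  by have := E (Y i h); rewrite !inE /= eqxx => /esym/eqP[_ ->].
have -> : 2 ^ k * k ^ 2 = #|{: k.-tuple bool * 'I_k * 'I_k}|.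
  by rewrite !card_prod card_tuple card_bool !card_ord -mulnA.
rewrite -(card_imset predT fI); apply: subset_leq_card.
apply/subsetP=> _ /imsetP[[[i j] h] _ ->]; apply/imsetP.
by exists (X i j, Y i h); rewrite ?inE /adj /cheap //= eqxx.
Qed.

Lemma size_log_le_cost (k : nat) : (2 <= k)%N ->
  ((#|edges (@adj k)| + #|{: vertex k}|) * (10 * k) <=
   3180 * cost (@adj k) (unit_partition (vertex k)))%N.
Proof.
move=> k2; have k0 : (0 < k)%N by apply: ltnW.
have := cost_unit k0; have := card_edges_le k2; have := card_vertex_le k2.
have -> : (2 ^ k = 2 * 2 ^ k.-1)%N by rewrite -expnS prednK.
move: (2 ^ k.-1)%N (cost _ _) #|_| #|_| => w c n m hn hm hc.
(* 159 = 130 + 58 / 2, and 3180 = 2 * 159 * 10, where the 2 turns [2 ^ k] into [2 ^ k.-1]. *)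
apply: (@leq_trans ((159 * (2 * w * k ^ 2)) * (10 * k))%N); last by nia.
rewrite leq_mul2r; apply/orP; right.
have : (2 * w * k * 2 <= 2 * w * k ^ 2)%N by rewrite -mulnn mulnA leq_mul2l k2 orbT.
nia.
Qed.

(** Uses [k < 2 ^ k] and 58 <= [2 ^ 6] <= [2 ^ (3 * k)]. *)
Lemma card_vertex_exp (k : nat) : (2 <= k)%N -> (#|{: vertex k}| <= 2 ^ (5 * k))%N.
Proof.
move=> k2; apply: leq_trans (card_vertex_le k2) _.
have -> : (5 * k = k + (k + 3 * k))%N by lia.
rewrite (expnD 2 k) (expnD 2 k) mulnCA leq_mul2l; apply/orP; right; rewrite mulnC.
apply: leq_mul; first exact/ltnW/ltn_expl.
have le6 : (6 <= 3 * k)%N by lia.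
by apply: leq_trans (leq_pexp2l _ le6).
Qed.

(** * The asymptotic bounds over the reals *)

Local Open Scope ring_scope.

Theorem theorem6 (R : realType) :
  exists c C : R, 0 < c /\ 0 < C /\
  forall k : nat, (2 <= k)%N ->
  exists (V : finType) (e : rel V),
    let n : R := #|V|%:R in
    let m : R := #|edges e|%:R in
    [/\ symmetric e,
        irreflexive e,
        c * (2 ^+ k * k%:R) <= n <= C * (2 ^+ k * k%:R),
        c * (2 ^+ k * k%:R ^+ 2) <= m <= C * (2 ^+ k * k%:R ^+ 2) &
        c * ((m + n) * ln n) <= (cost e (unit_partition V))%:R].
Proof.
(* 130 comes from the edges and also covers the 58 for the vertices. *)
exists 3180^-1, 130; split; first by rewrite invr_gt0 ltr0n.
split=> [|k k2]; first by rewrite ltr0n.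
have k0 : (0 < k)%N by apply: ltnW.
have c1 (x : R) : 0 <= x -> 3180^-1 * x <= x.
  by move=> x0; rewrite ler_piMl // invf_le1 ?ltr0n // ler1n.
exists (vertex k), (@adj k) => /=; split.
- exact: adj_sym.
- exact: adj_irr.
- rewrite -!natrX -!natrM; apply/andP; split.
    by apply: le_trans (c1 _ (ler0n _ _)) _; rewrite ler_nat card_vertex_ge.
  rewrite ler_nat; apply: leq_trans (card_vertex_le k2) _.
  by rewrite leq_mul2r orbT.
- rewrite -!natrX -!natrM; apply/andP; split.
    by apply: le_trans (c1 _ (ler0n _ _)) _; rewrite ler_nat card_edges_ge.
  by rewrite ler_nat card_edges_le.
have n0 : (0 < #|{: vertex k}|)%N.
  by apply: leq_trans (card_vertex_ge k); rewrite muln_gt0 expn_gt0 k0.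
(* The crude bound of [ln 2] by 2 turns the exponent [5 * k] into the factor [10 * k]. *)
have lnn : ln #|{: vertex k}|%:R <= (10 * k)%:R :> R.
  apply: (@le_trans _ _ (ln ((2 ^ (5 * k))%:R))).
    by rewrite ler_ln ?posrE ?ltr0n ?expn_gt0 // ler_nat card_vertex_exp.
  rewrite natrX lnXn ?ltr0n // -[leLHS]mulr_natr.
  have -> : (10 * k)%:R = 2 * (5 * k)%:R :> R by rewrite -natrM mulnA.
  by rewrite ler_wpM2r ?ler0n // ltW // ln_sublinear.
rewrite mulrC ler_pdivrMr ?ltr0n //.
apply: (@le_trans _ _ ((#|edges (@adj k)|%:R + #|{: vertex k}|%:R) * (10 * k)%:R)).
  by rewrite ler_wpM2l // addr_ge0 ?ler0n.
by rewrite -natrD -!natrM ler_nat mulnC [leqRHS]mulnC mulnC size_log_le_cost.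
Qed.
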